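(* Let $M$ be a Malcev algebra over $\mathbb{F}$ and $V$ a vector space of dimension $1$ with basis $\{u\}$. Then there exists a bijection between the set of extending structures of $M$ through $V$ and the set $\mathcal{F}(M)$ of twisted derivations of $M$. Under this bijection the extending structure $\Omega(M,V)=(\triangleleft,\triangleright,\omega,[\,,\,])$ corresponding to $(\lambda,D)\in\mathcal{F}(M)$ is given by $$x\triangleleft u=D(x),\qquad x\triangleright u=\lambda(x)u,\qquad \omega(u,u)=0,\qquad [u,u]=0\qquad (x\in M),$$ and the associated unified product $M\,\natural\,V$ has bracket determined by $$[(x,u),(y,u)]=\big([x,y]+D(x)-D(y),\ (\lambda(x)-\lambda(y))u\big)\qquad (x,y\in M).$$
   Context: All algebras and vector spaces are over an algebraically closed field $\mathbb{F}$ of characteristic different from $2$ and $3$. A Malcev algebra is a vector space $M$ with a bilinear operation $[\,,\,]:M\times M\to M$ such that $[x,y]=-[y,x]$ and $J(x,y,[x,z])=[J(x,y,z),x]$ for all $x,y,z\in M$, where $J(x,y,z)=[[x,y],z]+[[y,z],x]+[[z,x],y]$. An extending datum of a Malcev algebra $M$ through a vector space $V$ is a system $\Omega(M,V)=(\triangleleft,\triangleright,\omega,[\,,\,])$ consisting of two bilinear maps $\triangleright:M\times V\to V$ and $\triangleleft:M\times V\to M$ and two skew-symmetric bilinear maps $[\,,\,]:V\times V\to V$ and $\omega:V\times V\to M$. $M\,\natural\,V$ denotes the vector space $M\oplus V$ with the bracket $$[(x,u),(y,v)]=\big([x,y]+x\triangleleft v-y\triangleleft u+\omega(u,v),\ x\triangleright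 v-y\triangleright u+[u,v]\big).$$ The extending datum is called an extending structure, and $M\,\natural\,V$ the associated unified product, if this bracket makes $M\oplus V$ a Malcev algebra. A twisted derivation of $M$ is a pair $(\lambda,D)$ of linear maps $\lambda:M\to\mathbb{F}$, $D:M\to M$ such that for all $x,y,z\in M$: (T1) $[[x,z],D(y)]+\lambda(y)D([x,z])+\lambda([y,z])D(x)-[D([y,z]),x]+\lambda(z)[D(x),y]-[[D(z),x],y]-\lambda(x)\lambda(z)D(y)+[[D(x),y],z]-\lambda(x)[D(y),z]-D([[x,y],z])+\lambda(x)\lambda(y)D(z)=0$; (T2) $\lambda(D(y))D(x)-\lambda(x)D(D(y))+D([D(x),y])-[D(D(y)),x]+\lambda(y)D(D(x))-D(D([x,y]))+[D(x),D(y)]-\lambda(x)D(D(y))=0$; (T3) $\lambda(D([x,y]))-\lambda(D(x))\lambda(y)-\lambda([D(x),y])+\lambda(x)\lambda(D(y))=0$; (T4) $D([D(x),y])-\lambda(x)D(D(y))-[D(D(y)),x]+\lambda(D(y))D(x)+D([D(y),x])-\lambda(y)D(D(x))-[D(D(x)),y]+\lambda(D(x))D(y)=0$; (T5) $\lambda([D(x),y])+\lambda([D(y),x])=0$; (T6) $\lambda([x,z])\lambda(y)=\lambda([[x,y],z])-\lambda(x)\lambda([y,z])$. The set of twisted derivations of $M$ is denoted $\mathcal{F}(M)$. *)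

(* Defs.v *)
From mathcomp Require Import all_boot all_order all_algebra.
From mathcomp Require Import all_classical.

Set Implicit Arguments.
Unset Strict Implicit.
Unset Printing Implicit Defensive.

Import GRing.Theory.
Local Open Scope ring_scope.

Section Malcev.
Variables (F : fieldType) (A : lmodType F) (br : A -> A -> A).

Definition jacobian (x y z : A) : A :=
  br (br x y) z + br (br y z) x + br (br z x) y.

Definition malcev_algebra : Prop :=
  [/\ bilinear_for *:%R *:%R br,
      forall x y, br x y = - br y x
    & forall x y z, jacobian x y (br x z) = br (jacobian x y z) x].

End Malcev.

(* [ltri] is the map M x V -> M written with a left triangle, [rtri] the map
   M x V -> V written with a right triangle, [cocycle] is omega. *)
Record extending_datum (F : fieldType) (M V : lmodType F) := ExtendingDatum {
  ltri : {bilinear M -> V -> M};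
  rtri : {bilinear M -> V -> V};
  cocycle : {bilinear V -> V -> M};
  vbr : {bilinear V -> V -> V};
  cocycle_skew : forall u v, cocycle u v = - cocycle v u;
  vbr_skew : forall u v, vbr u v = - vbr v u
}.

Section ExtendingStructures.
Variables (F : fieldType) (M V : lmodType F) (br : M -> M -> M).

Definition unified_bracket (Om : extending_datum M V) (p q : M * V) : M * V :=
  (br p.1 q.1 + ltri Om p.1 q.2 - ltri Om q.1 p.2 + cocycle Om p.2 q.2,
   rtri Om p.1 q.2 - rtri Om q.1 p.2 + vbr Om p.2 q.2).

Definition extending_structures : set (extending_datum M V) :=
  [set Om | malcev_algebra (unified_bracket Om)].

End ExtendingStructures.

Section TwistedDerivations.
Variables (F : fieldType) (M : lmodType F) (br : M -> M -> M).
Variables (lam : {scalar M}) (D : {linear M -> M}).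
Local Notation "[[ x , y ]]" := (br x y).

Definition twder1 (x y z : M) : Prop :=
  [[ [[x, z]], D y ]] + lam y *: D [[x, z]] + lam [[y, z]] *: D x
  - [[ D [[y, z]], x ]] + lam z *: [[D x, y]] - [[ [[D z, x]], y ]]
  - (lam x * lam z) *: D y + [[ [[D x, y]], z ]] - lam x *: [[D y, z]]
  - D [[ [[x, y]], z ]] + (lam x * lam y) *: D z = 0.

Definition twder2 (x y : M) : Prop :=
  lam (D y) *: D x - lam x *: D (D y) + D [[D x, y]] - [[D (D y), x]]
  + lam y *: D (D x) - D (D [[x, y]]) + [[D x, D y]]
  - lam x *: D (D y) = 0.

Definition twder3 (x y : M) : Prop :=
  lam (D [[x, y]]) - lam (D x) * lam y - lam [[D x, y]]
  + lam x * lam (D y) = 0.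

Definition twder4 (x y : M) : Prop :=
  D [[D x, y]] - lam x *: D (D y) - [[D (D y), x]] + lam (D y) *: D x
  + D [[D y, x]] - lam y *: D (D x) - [[D (D x), y]]
  + lam (D x) *: D y = 0.

Definition twder5 (x y : M) : Prop := lam [[D x, y]] + lam [[D y, x]] = 0.

Definition twder6 (x y z : M) : Prop :=
  lam [[x, z]] * lam y = lam [[ [[x, y]], z ]] - lam x * lam [[y, z]].

Definition twisted_derivation : Prop :=
  forall x y z : M,
    [/\ twder1 x y z, twder2 x y, twder3 x y, twder4 x y & twder5 x y /\ twder6 x y z].

End TwistedDerivations.

Definition twisted_derivations (F : fieldType) (M : lmodType F)
    (br : M -> M -> M) : set ({scalar M} * {linear M -> M}) :=
  [set p | twisted_derivation br p.1 p.2].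

(* Main.v *)
(* Away from characteristic 2, a skew-symmetric bilinear bracket is Malcev iff
   it satisfies Sagle's identity
     [[x,z],[y,t]] = [[[x,y],z],t] + [[[y,z],t],x] + [[[z,t],x],y] + [[[t,x],y],z],
   which is multilinear and invariant under cyclic permutations of (x,y,z,t).
   On M + F u it therefore suffices to test it when every argument is in M or
   equal to u, up to rotation: MMMM is the identity of M, MMMu gives (T1) and
   (T6), MMuu gives (T2) and (T3), MuMu gives (T4) and (T5), and the patterns
   Muuu and uuuu hold trivially.  The forms on V x V vanish by skew-symmetry, so
   a datum amounts to the pair (lambda, D). *)
From HB Require Import structures.
Require Import Defs.
From mathcomp Require Import all_boot all_order all_algebra.
From mathcomp Require Import all_classical.
From mathcomp Require Import ring.

Set Implicit Arguments.
Unset Strict Implicit.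
Unset Printing Implicit Defensive.

Import GRing.Theory.
Local Open Scope ring_scope.

(** * Deciding linear identities in modules *)

(* Linear identities are proved by reflection: two formal linear combinations
   are equal as soon as, for each atom, their coefficients agree in the ring. *)
Inductive lexp (R : Type) :=
  | LVar of nat
  | LZero
  | LOpp of lexp R
  | LAdd of lexp R & lexp R
  | LScale of R & lexp R.
Arguments LVar {R}.
Arguments LZero {R}.

Section LinearCombinations.
Variables (R : comNzRingType) (A : lmodType R).

Fixpoint lexp_eval (env : seq A) (e : lexp R) : A :=
  match e with
  | LVar n => env`_n
  | LZero => 0
  | LOpp e1 => - lexp_eval env e1
  | LAdd e1 e2 => lexp_eval env e1 + lexp_eval env e2
  | LScale c e1 => c *: lexp_eval env e1
  end.

(** [eqn] on numerals computes under [cbn], so only scalar identities are left for [ring]. *)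
Fixpoint lexp_coef (i : nat) (e : lexp R) : R :=
  match e with
  | LVar n => if eqn i n then 1 else 0
  | LZero => 0
  | LOpp e1 => - lexp_coef i e1
  | LAdd e1 e2 => lexp_coef i e1 + lexp_coef i e2
  | LScale c e1 => c * lexp_coef i e1
  end.

Lemma lexp_evalE env e :
  lexp_eval env e = \sum_(i < size env) lexp_coef i e *: env`_i.
Proof.
elim: e => [n||e IH|e IHe f IHf|c e IH] /=.
- have [ltn|gen] := ltnP n (size env).
    rewrite (bigD1 (Ordinal ltn)) //= (_ : eqn n n); last exact: eqxx.
    rewrite scale1r big1 ?addr0 // => i ni.
    by rewrite (_ : eqn i n = false) ?scale0r //; apply: negbTE.
  (* A variable beyond [env] evaluates to the default 0, and no summation index equals it. *)
  rewrite nth_default // big1 // => i _; rewrite (_ : eqn i n = false) ?scale0r //.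
  exact: ltn_eqF (leq_trans (ltn_ord i) gen).
- by rewrite big1 // => i _; rewrite scale0r.
- by rewrite IH -sumrN; apply: eq_bigr => i _; rewrite scaleNr.
- by rewrite IHe IHf -big_split; apply: eq_bigr => i _; rewrite /= scalerDl.
- by rewrite IH scaler_sumr; apply: eq_bigr => i _; rewrite scalerA.
Qed.

(** A recursive conjunction rather than a quantifier over indices, so that [repeat split] yields one
    scalar goal per atom. *)
Fixpoint lexp_coef_eq (n : nat) (e f : lexp R) : Prop :=
  if n is n'.+1 then lexp_coef n' e = lexp_coef n' f /\ lexp_coef_eq n' e f
  else True.

Lemma lexp_eval_eq env e f :
  lexp_coef_eq (size env) e f -> lexp_eval env e = lexp_eval env f.
Proof.
move=> ef; rewrite !lexp_evalE; apply: eq_bigr => -[i /= lti] _; congr (_ *: _).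
elim: (size env) lti ef => //= n IH; rewrite ltnS leq_eqVlt => lti [efn efs].
by case/orP: lti => [/eqP -> //|lti]; apply: IH.
Qed.

End LinearCombinations.

(* Atoms are compared up to conversion, as canonical instances may differ. *)
Ltac lexp_index x env :=
  match env with
  | ?y :: _ => let _ := match constr:(tt) with _ => unify x y end in constr:(0%N)
  | _ :: ?env' => let n := lexp_index x env' in constr:(n.+1)
  end.

Ltac lexp_add x env :=
  match env with
  | _ => let n := lexp_index x env in env
  | _ => constr:(x :: env)
  end.

Ltac lexp_env env t :=
  lazymatch t with
  | GRing.add ?a ?b => let env := lexp_env env a in lexp_env env b
  | GRing.opp ?a => lexp_env env a
  | GRing.scale _ ?a => lexp_env env a
  | GRing.zero => env
  | _ => lexp_add t env
  end.

Ltac lexp_quote R env t :=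
  lazymatch t with
  | GRing.add ?a ?b =>
      let a := lexp_quote R env a in
      let b := lexp_quote R env b in constr:(@LAdd R a b)
  | GRing.opp ?a => let a := lexp_quote R env a in constr:(@LOpp R a)
  | GRing.scale ?c ?a => let a := lexp_quote R env a in constr:(@LScale R c a)
  | GRing.zero => constr:(@LZero R)
  | _ => let n := lexp_index t env in constr:(@LVar R n)
  end.

Ltac lmodule R :=
  lazymatch goal with
  | |- @eq ?A ?l ?r =>
    let env := lexp_env (@nil A) l in
    let env := lexp_env env r in
    let e := lexp_quote R env l in
    let f := lexp_quote R env r in
    apply: (@lexp_eval_eq _ _ env e f);
    cbn [lexp_coef_eq size lexp_coef eqn]; repeat split; ring
  end.

(** * Sagle's identity and the Malcev identity *)

Section Sagle.
Variables (F : fieldType) (A : lmodType F) (br : {bilinear A -> A -> A}).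

Definition sagle (x y z t : A) : A :=
  br (br x z) (br y t) - br (br (br x y) z) t - br (br (br y z) t) x
  - br (br (br z t) x) y - br (br (br t x) y) z.

Hypothesis char_neq2 : 2%N \notin [pchar F].
Hypothesis brC : forall x y, br x y = - br y x.

Lemma double_eq0 (B : lmodType F) (v : B) : v + v = 0 -> v = 0.
Proof.
move/eqP; rewrite -[v + v]mulr2n -scaler_nat scaler_eq0 => /orP[two0|/eqP //].
by case/negP: char_neq2; rewrite inE /= two0.
Qed.

Lemma skew_diag0 (B : lmodType F) (v : B) : v = - v -> v = 0.
Proof. by move=> vN; apply: double_eq0; rewrite {2}vN subrr. Qed.

(** Rotation permutes the four left-normed products cyclically, and [[y,t],[z,x]] = [[x,z],[y,t]] by
    two sign changes. *)
Lemma sagle_rot x y z t : sagle y z t x = sagle x y z t.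
Proof.
rewrite /sagle [br (br y t) _]brC [br z x]brC linearNl; lmodule F.
Qed.

(** At t = x Sagle's expression becomes the defect of the Malcev identity, so Sagle's identity
    specializes to it. *)
Lemma jacobian_sagle x y z :
  jacobian br x y (br x z) - br (jacobian br x y z) x = sagle x y z x.
Proof.
rewrite /jacobian /sagle !linearDl [br (br x y) (br x z)]brC [br y x]brC.
rewrite [br x x](skew_diag0 (brC x x)) !linear0l [br y (br x z)]brC [br x z]brC.
rewrite !(linearNl, linearNr); lmodule F.
Qed.

(** Polarization: the identity is quadratic in [x], and its instances at [x] and [w] are removed
    from the one at [x + w]. *)
Lemma malcev_linearized :
  (forall x y z, jacobian br x y (br x z) = br (jacobian br x y z) x) ->
  forall x w y z, jacobian br x y (br w z) + jacobian br w y (br x z)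
  - br (jacobian br x y z) w - br (jacobian br w y z) x = 0.
Proof.
move=> malc x w y z.
have := malc (x + w) y z => /eqP; rewrite -subr_eq0 => /eqP <-.
have /eqP := malc x y z; rewrite -subr_eq0 => /eqP e1.
have /eqP := malc w y z; rewrite -subr_eq0 => /eqP e2.
rewrite -[LHS]addr0 -[in LHS]e1 -[LHS]addr0 -[in LHS]e2.
rewrite /jacobian !(linearDl, linearDr).
lmodule F.
Qed.

Lemma malcev_sagle :
  (forall x y z, jacobian br x y (br x z) = br (jacobian br x y z) x) ->
  forall x y z t, sagle x y z t = 0.
Proof.
move=> /malcev_linearized L x y z t; apply: double_eq0.
(* Twice Sagle's expression is an alternating sum of three linearizations. *)
transitivity ((jacobian br x z (br y t) + jacobian br y z (br x t)
               - br (jacobian br x z t) y - br (jacobian br y z t) x)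
  - (jacobian br x t (br z y) + jacobian br z t (br x y)
     - br (jacobian br x t y) z - br (jacobian br z t y) x)
  + (jacobian br x y (br t z) + jacobian br t y (br x z)
     - br (jacobian br x y z) t - br (jacobian br t y z) x)); last first.
  by rewrite !L subrr addr0.
rewrite /jacobian /sagle !linearDl.
(* Products are oriented consistently by skew-symmetry, so that equal terms become one atom for
   [lmodule]. *)
rewrite [br y x]brC [br z x]brC [br t x]brC [br z y]brC [br t y]brC [br t z]brC.
rewrite !(linearNl, linearNr).
rewrite [br (br y z) (br x t)]brC [br (br z t) (br x y)]brC.
rewrite [br (br y t) (br x z)]brC.
rewrite ![br y (br _ _)]brC ![br z (br _ _)]brC ![br t (br _ _)]brC.
rewrite !(linearNl, linearNr).
lmodule F.
Qed.
End Sagle.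

(** * The unified bracket as a skew-symmetric bilinear product *)

Section UnifiedProduct.
Variables (F : fieldType) (M V : lmodType F) (br : {bilinear M -> M -> M}).
Variable Om : extending_datum M V.

Lemma unified_bracket_bilinear :
  bilinear_for *:%R *:%R (unified_bracket br Om).
Proof.
split=> [q a p p'|p a q q']; congr pair => /=;
  rewrite !(linearDl, linearDr, linearZl_LR, linearZr_LR) /=; lmodule F.
Qed.

HB.instance Definition _ := bilinear_isBilinear.Build F (M * V)%type (M * V)%type
  (M * V)%type *:%R *:%R (unified_bracket br Om) unified_bracket_bilinear.

Lemma unified_bracket_skew : (forall x y, br x y = - br y x) ->
  forall p q, unified_bracket br Om p q = - unified_bracket br Om q p.
Proof.
move=> brC [x v] [y w]; congr pair => /=.
  rewrite brC cocycle_skew; lmodule F.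
rewrite vbr_skew; lmodule F.
Qed.

End UnifiedProduct.

(** * The datum on a line attached to a pair (lambda, D) *)

Section LineDatum.
Variables (F : fieldType) (M V : lmodType F) (c : {scalar V}).
Variables (lam : {scalar M}) (D : {linear M -> M}).

(** With [c] the coordinate along the basis vector u, this extends the prescribed value [D x] at u
    linearly to all of [V]. *)
Definition line_ltri (x : M) (v : V) : M := c v *: D x.

Lemma line_ltri_bilinear : bilinear_for *:%R *:%R line_ltri.
Proof.
by split=> [v|x] a y z; rewrite /line_ltri linearP /=;
  rewrite ?scalerDr ?scalerDl !scalerA // mulrC.
Qed.

HB.instance Definition _ := bilinear_isBilinear.Build F M V M *:%R *:%R
  line_ltri line_ltri_bilinear.

Definition line_rtri (x : M) (v : V) : V := lam x *: v.

Lemma line_rtri_bilinear : bilinear_for *:%R *:%R line_rtri.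
Proof.
by split=> [v|x] a y z; rewrite /line_rtri ?linearP /=;
  rewrite ?scalerDr ?scalerDl !scalerA // mulrC.
Qed.

HB.instance Definition _ := bilinear_isBilinear.Build F M V V *:%R *:%R
  line_rtri line_rtri_bilinear.

Definition zero_form (W : lmodType F) (v w : V) : W := 0.

Lemma zero_form_bilinear (W : lmodType F) : bilinear_for *:%R *:%R (@zero_form W).
Proof. by split=> v a x y; rewrite /zero_form -[RHS]/(a *: 0 + 0) scaler0 addr0. Qed.

HB.instance Definition _ (W : lmodType F) := bilinear_isBilinear.Build F V V W *:%R *:%R
  (@zero_form W) (@zero_form_bilinear W).

Lemma zero_form_skew (W : lmodType F) v w : zero_form W v w = - zero_form W w v.
Proof. by rewrite oppr0. Qed.

Definition line_datum : extending_datum M V :=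
  @ExtendingDatum F M V line_ltri line_rtri (@zero_form M) (@zero_form V)
    (@zero_form_skew M) (@zero_form_skew V).

End LineDatum.

(** * Sagle's identity on M + F u, one argument pattern at a time *)

Section LineExtension.
Variables (F : fieldType) (M V : lmodType F) (br : {bilinear M -> M -> M}).
Variables (lam : {scalar M}) (D : {linear M -> M}) (u : V) (c : {scalar V}).
Hypothesis cu : c u = 1.
Local Notation E := (M * V)%type.
Variable B : {bilinear E -> E -> E}.
Hypothesis BE : forall x y v w, B (x, v) (y, w) =
  (br x y + c w *: D x - c v *: D y, lam x *: w - lam y *: v).

(** The difference [k - l] fits (T6), an equation between two scalars; (T3) and (T5) use it with one
    of them equal to 0. *)
Lemma pair_line_eq0 (m : M) (k l : F) :
  ((m, (k - l) *: u) : E) = 0 <-> m = 0 /\ k = l.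
Proof.
split=> [[-> /(congr1 c)]|[-> ->]]; last by rewrite subrr scale0r.
by rewrite linearZ_LR linear0 cu /= mulr1 => /eqP; rewrite subr_eq0 => /eqP.
Qed.

Let simp := (linear0 D, linear0 lam, linear0 c, linearZ_LR c, cu,
  @linear0l _ _ _ _ _ _ br, @linear0r _ _ _ _ _ _ br,
  scale0r, scale1r, scaler0, subr0, addr0, add0r, sub0r, oppr0, mulr1).

(** This and the next rules form the multiplication table for the products met in Sagle's
    expression, where second components are 0, [u] or multiples of [u]. *)
Let Bmm x y : B (x, 0) (y, 0) = (br x y, 0).
Proof. by rewrite BE !simp. Qed.

Let Bmu x : B (x, 0) (0, u) = (D x, lam x *: u).
Proof. by rewrite BE !simp. Qed.

Let Bum x : B (0, u) (x, 0) = (- D x, (- lam x) *: u).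
Proof. by rewrite BE !simp scaleNr. Qed.

Let Buu : B (0, u) (0, u) = 0.
Proof. by rewrite BE !simp. Qed.

Let Bkm x k y : B (x, k *: u) (y, 0) =
  (br x y - k *: D y, (- (lam y * k)) *: u).
Proof. by rewrite BE !simp /= ?mulr1 ?scaleNr ?scalerA. Qed.

Let Bku x k : B (x, k *: u) (0, u) = (D x, lam x *: u).
Proof. by rewrite BE !simp. Qed.

Let Bkk x y k l : B (x, k *: u) (y, l *: u) =
  (br x y + l *: D x - k *: D y, (lam x * l - lam y * k) *: u).
Proof. by rewrite BE !simp /= ?mulr1 ?scalerA scalerBl. Qed.

Let Bmk x y l : B (x, 0) (y, l *: u) = (br x y + l *: D x, (lam x * l) *: u).
Proof. by rewrite BE !simp /= ?mulr1 ?scalerA. Qed.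

Let fstB (p q : E) : (p - q).1 = p.1 - q.1. Proof. by []. Qed.
Let sndB (p q : E) : (p - q).2 = p.2 - q.2. Proof. by []. Qed.

(* The rules for 0 come first, because 0 : M * V unifies with (x, 0). *)
Let BS := (@linear0l _ _ _ _ _ _ B, @linear0r _ _ _ _ _ _ B,
  Bmm, Bmu, Bum, Buu, Bku, Bkm, Bkk, Bmk).
Let brS := (@linearDl _ _ _ _ _ _ br, @linearDr _ _ _ _ _ _ br,
  @linearNl _ _ _ _ _ _ br, @linearNr _ _ _ _ _ _ br,
  @linearZl_LR _ _ _ _ _ _ br, @linearZr_LR _ _ _ _ _ _ br,
  @linear0l _ _ _ _ _ _ br, @linear0r _ _ _ _ _ _ br).
Let DS := (linearD D, linearN D, linearZ_LR D, linear0 D).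
Let lamS := (linearD lam, linearN lam, linearZ_LR lam, linear0 lam).

Let eq_components (p : E) m k : p.1 = m -> p.2 = k -> p = (m, k).
Proof. by case: p => /= _ _ -> ->. Qed.

(** The M-component is the left side of (T1); in the V-component the two terms cubic in [lam]
    cancel, which leaves (T6). *)
Lemma sagle_MMMU x y z :
  sagle B (x, 0) (y, 0) (z, 0) (0, u) = 0 <->
  twder1 br lam D x y z /\ twder6 br lam x y z.
Proof.
rewrite /twder1 /twder6; set m := (X in X = 0 /\ _); set k := (X in _ /\ X = _).
set l := (X in _ /\ k = X); rewrite -pair_line_eq0.
suff -> : sagle B (x, 0) (y, 0) (z, 0) (0, u) = (m, (k - l) *: u) by [].
apply: eq_components; rewrite /sagle ?(fstB, sndB) !BS /=.
  rewrite /m !(brS, DS); lmodule F.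
rewrite /k /l ?(brS, lamS); lmodule F.
Qed.

Lemma sagle_MMUU x y :
  sagle B (x, 0) (y, 0) (0, u) (0, u) = 0 <->
  twder2 br lam D x y /\ twder3 br lam D x y.
Proof.
rewrite /twder2 /twder3; set m := (X in X = 0 /\ _); set k := (X in _ /\ X = 0).
rewrite -pair_line_eq0.
(* The V-component is the left side of (T3) with opposite sign. *)
suff -> : sagle B (x, 0) (y, 0) (0, u) (0, u) = (m, (0 - k) *: u).
  by rewrite !pair_line_eq0; split=> -[m0 k0]; split.
apply: eq_components; rewrite /sagle ?(fstB, sndB) !BS /=.
  rewrite /m ?(brS, DS); lmodule F.
rewrite /k ?(brS, lamS); lmodule F.
Qed.

Lemma sagle_MUMU x y :
  sagle B (x, 0) (0, u) (y, 0) (0, u) = 0 <->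
  twder4 br lam D x y /\ twder5 br lam D x y.
Proof.
rewrite /twder4 /twder5; set m := (X in X = 0 /\ _); set k := (X in _ /\ X = 0).
rewrite -pair_line_eq0.
(* Here both components have the sign opposite to (T4) and (T5). *)
suff -> : sagle B (x, 0) (0, u) (y, 0) (0, u) = (- m, (0 - k) *: u).
  by rewrite !pair_line_eq0; split=> -[/eqP m0 k0]; split=> //; apply/eqP;
     move: m0; rewrite oppr_eq0.
apply: eq_components; rewrite /sagle ?(fstB, sndB) !BS /=.
  rewrite /m ?(brS, DS); lmodule F.
rewrite /k ?(brS, lamS); lmodule F.
Qed.

(** Terms containing [u,u] vanish, and the remaining two, [[[x,u],u],u] and [[[u,x],u],u],
    cancel. *)
Lemma sagle_MUUU x : sagle B (x, 0) (0, u) (0, u) (0, u) = 0.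
Proof.
apply: eq_components; rewrite /sagle ?(fstB, sndB) !BS /=.
  rewrite ?(brS, DS); lmodule F.
rewrite ?(brS, lamS); lmodule F.
Qed.

Lemma sagle_MMMM x y z t :
  sagle B (x, 0) (y, 0) (z, 0) (t, 0) = (sagle br x y z t, 0).
Proof. by rewrite /sagle !BS; apply: eq_components; rewrite /= ?subr0. Qed.

Lemma sagle_UUUU : sagle B (0, u) (0, u) (0, u) (0, u) = 0.
Proof. by rewrite /sagle !BS !subr0. Qed.

Hypothesis cK : forall v, v = c v *: u.

(** Sagle's expression is linear in its first slot, and M together with [u] spans the space;
    rotation will bring the other slots to the front. *)
Lemma sagle_line_ind q r s :
    (forall x, sagle B (x, 0) q r s = 0) -> sagle B (0, u) q r s = 0 ->
  forall p, sagle B p q r s = 0.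
Proof.
move=> Sm Su [x v].
have -> : (x, v) = (x, 0) + c v *: (0, u).
  by apply: eq_components; rewrite /= ?scaler0 ?addr0 ?add0r -?cK.
transitivity (sagle B (x, 0) q r s + c v *: sagle B (0, u) q r s); last first.
  by rewrite Sm Su scaler0 addr0.
rewrite /sagle !(@linearDl _ _ _ _ _ _ B, @linearZl_LR _ _ _ _ _ _ B,
  @linearDr _ _ _ _ _ _ B, @linearZr_LR _ _ _ _ _ _ B).
lmodule F.
Qed.

Lemma sagle_twder : (forall p q, B p q = - B q p) ->
    (forall x y z t, sagle br x y z t = 0) ->
  (forall p q r s, sagle B p q r s = 0) <-> twisted_derivation br lam D.
Proof.
move=> BC SM; split=> [SB x y z|T].
  have [T1 T6] := (sagle_MMMU x y z).1 (SB _ _ _ _).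
  have [T2 T3] := (sagle_MMUU x y).1 (SB _ _ _ _).
  by have [T4 T5] := (sagle_MUMU x y).1 (SB _ _ _ _).
have S0 x y z t : sagle B (x, 0) (y, 0) (z, 0) (t, 0) = 0.
  by rewrite sagle_MMMM SM.
have S1 x y z : sagle B (x, 0) (y, 0) (z, 0) (0, u) = 0.
  by apply/sagle_MMMU; have [? _ _ _ []] := T x y z.
have S2 x y : sagle B (x, 0) (y, 0) (0, u) (0, u) = 0.
  (* (T2) and (T3) do not involve the third argument, so any value, here 0, will do. *)
  by apply/sagle_MMUU; have [] := T x y 0.
have S2' x y : sagle B (x, 0) (0, u) (y, 0) (0, u) = 0.
  by apply/sagle_MUMU; have [_ _ _ ? []] := T x y 0.
have SE := (S0, S1, S2, S2', sagle_MUUU, sagle_UUUU).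
(* Each rotation exposes the next slot for splitting; every resulting pattern is then at most two
   rotations forward or one backward from a known case. *)
move=> p q r s; move: p; apply: sagle_line_ind => [x|]; rewrite -sagle_rot //;
  move: q; apply: sagle_line_ind => [y|]; rewrite -sagle_rot //;
  move: r; apply: sagle_line_ind => [z|]; rewrite -sagle_rot //;
  move: s; apply: sagle_line_ind => [t|];
  first [by rewrite SE | by rewrite -sagle_rot // SE
        | by rewrite -sagle_rot // -sagle_rot // SE
        | by rewrite sagle_rot // SE].
Qed.

End LineExtension.

(** * Extensionality of bundled maps and data, and the bijection *)

Lemma bilinear_forP (R : nzRingType) (U U' W : lmodType R) (f : U -> U' -> W) :
  bilinear_for *:%R *:%R f -> exists g : {bilinear U -> U' -> W}, f = g.
Proof.
move=> fB; pose m := @bilinear_isBilinear.Build R U U' W *:%R *:%R f fB.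
pose g : {bilinear U -> U' -> W} := HB.pack f m.
by exists g.
Qed.

Lemma bilinear_eq (R : nzRingType) (U U' W : lmodType R)
  (f g : {bilinear U -> U' -> W}) : f =2 g -> f = g.
Proof.
case: f g => [f [[f1 f2 f3 f4]]] [g [[g1 g2 g3 g4]]] /= fg.
have {}fg : f = g by apply/funext => x; apply/funext => y; apply: fg.
subst g; rewrite (Prop_irrelevance f1 g1) (Prop_irrelevance f2 g2).
by rewrite (Prop_irrelevance f3 g3) (Prop_irrelevance f4 g4).
Qed.

(** The scaling [s] is arbitrary in order to cover both linear forms and endomorphisms. *)
Lemma linear_eq (R : nzRingType) (U : lmodType R) (W : zmodType)
    (s : R -> W -> W) (f g : {linear U -> W | s}) : f =1 g -> f = g.
Proof.
case: f g => [f [[f1] [f2]]] [g [[g1] [g2]]] /= /funext fg; subst g.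
by rewrite (Prop_irrelevance f1 g1) (Prop_irrelevance f2 g2).
Qed.

Lemma extending_datum_eq (F : fieldType) (M V : lmodType F)
    (Om Om' : extending_datum M V) :
    ltri Om =2 ltri Om' -> rtri Om =2 rtri Om' ->
    cocycle Om =2 cocycle Om' -> vbr Om =2 vbr Om' ->
  Om = Om'.
Proof.
case: Om Om' => [f1 f2 f3 f4 s3 s4] [g1 g2 g3 g4 t3 t4] /=.
move=> /bilinear_eq e1 /bilinear_eq e2 /bilinear_eq e3 /bilinear_eq e4; subst.
by rewrite (Prop_irrelevance s3 t3) (Prop_irrelevance s4 t4).
Qed.

Lemma malcev_algebraP (F : fieldType) (A : lmodType F) (br : {bilinear A -> A -> A}) :
    2%N \notin [pchar F] -> (forall x y, br x y = - br y x) ->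
  malcev_algebra br <-> forall x y z t, sagle br x y z t = 0.
Proof.
move=> ch2 brC; split=> [[_ _]|S0]; first exact: malcev_sagle.
split=> // [|x y z].
  by split=> a b x y; [rewrite linearPl | rewrite linearPr].
by apply/eqP; rewrite -subr_eq0 jacobian_sagle // S0.
Qed.

Theorem proposition4p2 (F : closedFieldType)
    (char_neq2 : 2%N \notin [pchar F]) (char_neq3 : 3%N \notin [pchar F])
    (M : lmodType F) (br : M -> M -> M) (malcevM : malcev_algebra br)
    (V : vectType F) (u : V)
    (dimV : \dim {:V} = 1%N) (basis_u : basis_of {:V} [:: u]) :
  exists Phi : {scalar M} * {linear M -> M} -> extending_datum M V,
    set_bij (twisted_derivations br) (extending_structures br) Phi /\
    forall (lam : {scalar M}) (D : {linear M -> M}),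
      twisted_derivations br (lam, D) ->
      let Om := Phi (lam, D) in
      [/\ forall x, ltri Om x u = D x,
          forall x, rtri Om x u = lam x *: u,
          cocycle Om u u = 0,
          vbr Om u u = 0
        & (forall x y : M,
             unified_bracket br Om (x, u) (y, u)
             = (br x y + D x - D y, (lam x - lam y) *: u))
          /\ (forall B : M * V -> M * V -> M * V,
                bilinear_for *:%R *:%R B ->
                (forall x y : M,
                   B (x, u) (y, u)
                   = (br x y + D x - D y, (lam x - lam y) *: u)) ->
                B = unified_bracket br Om)].
Proof.
have [/bilinear_forP[br' brE] brC _] := malcevM; subst br.
have SM := (malcev_algebraP char_neq2 brC).1 malcevM.
pose c : {scalar V} := coord [tuple u] ord0.
have cK v : v = c v *: u.
  by rewrite {1}(coord_basis (X := [tuple u]) basis_u (memvf v)) big_ord1.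
have cu : c u = 1.
  exact: (coord_free ord0 ord0 (basis_free (X := [tuple u]) basis_u)).
pose Phi (p : {scalar M} * {linear M -> M}) := line_datum c p.1 p.2.
have ltriE p x : ltri (Phi p) x u = p.2 x.
  by rewrite /= /line_ltri cu scale1r.
have rtriE p x : rtri (Phi p) x u = p.1 x *: u by [].
have BE p x y v w : unified_bracket br' (Phi p) (x, v) (y, w) =
    (br' x y + c w *: p.2 x - c v *: p.2 y, p.1 x *: w - p.1 y *: v).
  by congr pair; rewrite /= addr0.
have PhiP p : extending_structures br' (Phi p) <-> twisted_derivations br' p.
  have BC := unified_bracket_skew (Phi p) brC.
  apply: iff_trans (malcev_algebraP (br := unified_bracket br' (Phi p))
    char_neq2 BC) _.
  exact: (sagle_twder cu (BE p) cK BC SM).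
exists Phi; split; first split.
- by move=> p /PhiP.
- move=> [lam D] [lam' D'] _ _ PhiE; congr pair; apply: linear_eq => x.
    have /(congr1 c) := congr1 (fun Om => rtri Om x u) PhiE.
    by rewrite !rtriE !linearZ_LR cu /= !mulr1.
  by have := congr1 (fun Om => ltri Om x u) PhiE; rewrite !ltriE.
- move=> Om OmP.
  (* The preimage is read off from the two actions on [u]; [c] extracts the scalar from the V-valued
     one. *)
  pose lam : {scalar M} := c \o applyr (rtri Om) u.
  pose D : {linear M -> M} := applyr (ltri Om) u.
  have PhiOm : Phi (lam, D) = Om.
    apply: extending_datum_eq => [x v|x v|v w|v w] /=.
    + by rewrite /line_ltri /= [in RHS](cK v) linearZr_LR.
    + rewrite /line_rtri /= [in RHS](cK v) linearZr_LR /=.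
      by rewrite [in RHS](cK (rtri Om x u)) scalerA mulrC -scalerA -cK.
    (* By bilinearity the form is a multiple of its value at (u,u), which is 0 by skew-symmetry away
       from characteristic 2. *)
    + rewrite /zero_form [in RHS](cK v) [in RHS](cK w).
      rewrite linearZr_LR linearZl_LR /=.
      by rewrite (skew_diag0 char_neq2 (cocycle_skew Om u u)) !scaler0.
    + rewrite /zero_form [in RHS](cK v) [in RHS](cK w).
      rewrite linearZr_LR linearZl_LR /=.
      by rewrite (skew_diag0 char_neq2 (vbr_skew Om u u)) !scaler0.
  by exists (lam, D) => //; apply/PhiP; rewrite PhiOm.
move=> lam D _ Om; split=> //.
  by move=> x; apply: ltriE.
have OmE x y : unified_bracket br' Om (x, u) (y, u)
    = (br' x y + D x - D y, (lam x - lam y) *: u).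
  by rewrite BE cu !scale1r scalerBl.
split=> // B /bilinear_forP[B' ->] B'E.
apply/funext => -[x v]; apply/funext => -[y w].
(* The vectors (z,u) span M + V, since (0,u) is one of them; hence their products determine a
   bilinear bracket. *)
have split_line z t : (z, t) = ((z, u) - (0, u)) + c t *: (0, u) :> M * V.
  apply/eqP/andP; split; apply/eqP; rewrite /= ?subr0 ?scaler0 ?addr0 //.
  by rewrite subrr add0r -cK.
pose Om' : {bilinear M * V -> M * V -> M * V} := unified_bracket br' Om.
rewrite -[RHS]/(Om' (x, v) (y, w)) (split_line x v) (split_line y w).
rewrite !(linearDl, linearNl, linearZl_LR, linearDr, linearNr, linearZr_LR).
by rewrite !B'E !(OmE : forall x y, Om' (x, u) (y, u) = _).
Qed.
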